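(* Let $0<\alpha<1$, $\tau>0$, let $\lambda$ be a (real or complex) constant, let $f:[0,+\infty)\to\mathbb{R}$ be continuous, and let $\phi(t)=(t/\tau+1)y_0$, $t\in[-\tau,0]$, for some $y_0\in\mathbb{R}$. Let $y$ be the solution of $$ {}^{C}\!D^{\alpha}_{0}y(t)=\lambda y(t-\tau)+f(t)\ (t>0),\qquad y(t)=\phi(t)\ (-\tau\le t\le0), $$ and let $\hat y$ be the solution of $$ {}^{\phi_\tau}\!D^{\alpha}_{0}\hat y(t)=\lambda\hat y(t-\tau)+f(t)\ (t>0),\qquad \hat y(t)=\phi(t)\ (-\tau\le t\le0). $$ Then for every $t>0$ $$ \hat y(t)-y(t)=\frac{y_0}{\tau}\sum_{k=0}^{\lfloor t/\tau\rfloor}\lambda^{k}\left[\frac{(t-k\tau)^{\alpha k+1}}{\Gamma(\alpha k+2)}-\frac{(t+\tau-k\tau)^{\alpha k+1}}{\Gamma(\alpha k+2)}\left(1-I_{\frac{\tau}{t+\tau-k\tau}}\bigl(2-\alpha,(k+1)\alpha\bigr)\right)\right]. $$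
   Context: $I_x(a,b)=\frac{1}{B(a,b)}\int_0^x r^{a-1}(1-r)^{b-1}\,dr$ is the (regularized) incomplete beta function, with $B(a,b)$ the Euler beta function. For a starting point $t_0$, the Caputo derivative is ${}^{C}\!D^{\alpha}_{t_0}u(t)=\frac{1}{\Gamma(1-\alpha)}\int_{t_0}^t(t-r)^{-\alpha}u'(r)\,dr$. The operator ${}^{\phi_\tau}\!D^{\alpha}_{0}$ is the Grünwald-Letnikov derivative modified to incorporate the initial function: ${}^{\phi_\tau}\!D^{\alpha}_{0}u(t)=\lim_{h\to0^+}h^{-\alpha}\sum_{j=0}^\infty\omega_j^{(\alpha)}u^{\phi_\tau}(t-jh)$, with $\omega_j^{(\alpha)}=\frac{(-1)^j\Gamma(\alpha+1)}{j!\,\Gamma(\alpha-j+1)}$, where $u^{\phi_\tau}$ equals $\phi(-\tau)$ on $(-\infty,-\tau)$, $\phi$ on $[-\tau,0]$, and $u$ on $(0,\infty)$. It satisfies ${}^{\phi_\tau}\!D^{\alpha}_{0}u={}^{C}\!D^{\alpha}_{0}u+{}^{C}\!D^{\alpha}_{-\tau}\phi-{}^{C}\!D^{\alpha}_{0}\phi$ (for $t>0$, $\phi$ is extended by the same formula $\phi(t)=(t/\tau+1)y_0$), so the problem for $\hat y$ is understood as the equivalent problem $${}^{C}\!D^{\alpha}_{0}\hat y(t)=\lambda\hat y(t-\tau)+f(t)+c(t),\qquad c(t)={}^{C}\!D^{\alpha}_{0}\phi(t)-{}^{C}\!D^{\alpha}_{-\tau}\phi(t)=\frac{y_0}{\tau\,\Gamma(2-\alpha)}\bigl(t^{1-\alpha}-(t+\tau)^{1-\alpha}\bigr),$$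 with $\hat y=\phi$ on $[-\tau,0]$. A solution of a problem ${}^{C}\!D^{\alpha}_{0}u(t)=\lambda u(t-\tau)+F(t)$, $u=\phi$ on $[-\tau,0]$, is a continuous function on $[-\tau,\infty)$ with $u=\phi$ on $[-\tau,0]$ satisfying the equivalent integral form $u(t)=\phi(0)+\frac{1}{\Gamma(\alpha)}\int_0^t(t-r)^{\alpha-1}\bigl[\lambda u(r-\tau)+F(r)\bigr]dr$ for $t\ge0$. *)

(* Defs.v *)
From HB Require Import structures.
From mathcomp Require Import all_boot all_order all_algebra.
From mathcomp Require Import complex.
From mathcomp Require Import all_classical all_reals all_analysis.

Set Implicit Arguments.
Unset Strict Implicit.
Unset Printing Implicit Defensive.

Import Order.TTheory GRing.Theory Num.Theory.
Import numFieldNormedType.Exports.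

Local Open Scope classical_set_scope.
Local Open Scope ring_scope.

(* In all the integrals below the kernels use [powR], whose value at a zero
   base is finite; a singularity at an end point of the interval of
   integration therefore only alters the integrand on a null set. *)

Definition euler_gamma (R : realType) (x : R) : R :=
  \int[lebesgue_measure]_(r in `]0, +oo[) (r `^ (x - 1) * expR (- r)).

Definition euler_beta (R : realType) (a b : R) : R :=
  \int[lebesgue_measure]_(r in `[0, 1]) (r `^ (a - 1) * (1 - r) `^ (b - 1)).

Definition incomplete_beta (R : realType) (x a b : R) : R :=
  (euler_beta a b)^-1 *
  \int[lebesgue_measure]_(r in `[0, x]) (r `^ (a - 1) * (1 - r) `^ (b - 1)).

Definition caputo (R : realType) (alpha t0 : R) (u : R -> R) (t : R) : R :=
  (euler_gamma (1 - alpha))^-1 *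
  \int[lebesgue_measure]_(r in `[t0, t]) ((t - r) `^ (- alpha) * derive1 u r).

Definition integralC (R : realType) (D : set R) (g : R -> R[i]) : R[i] :=
  Complex (\int[lebesgue_measure]_(r in D) complex.Re (g r))
          (\int[lebesgue_measure]_(r in D) complex.Im (g r)).

(* Solutions, in integral form, of the Caputo delay problem
     D^alpha u(t) = lambda u(t - tau) + F(t)  (t > 0),
     u = phi on [-tau, 0],
   with 0 as starting point. Only the values of [u] on [-tau, +oo[ are
   relevant. The alias [R[i]^o] carries the topology given by the modulus. *)
Definition delay_solution (R : realType) (alpha tau : R) (lambda : R[i])
    (phi F : R -> R) (u : R -> R[i]) : Prop :=
  [/\ {within `[- tau, +oo[, continuous (u : R -> R[i]^o)},
      forall t : R, - tau <= t <= 0 -> u t = (phi t)%:C%C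
    & forall t : R, 0 <= t ->
        u t = (phi 0)%:C%C + ((euler_gamma alpha)^-1)%:C%C *
          integralC `[0, t] (fun r => ((t - r) `^ (alpha - 1))%:C%C *
                                      (lambda * u (r - tau) + (F r)%:C%C))].

Definition affine_history (R : realType) (tau y0 : R) (t : R) : R :=
  (t / tau + 1) * y0.

(* The Gruenwald-Letnikov derivative modified by the initial function [phi]
   equals
     caputo alpha 0 u + caputo alpha (- tau) phi - caputo alpha 0 phi,
   with [phi] extended to t > 0; hence the problem for this derivative is the
   Caputo problem whose forcing term is augmented by [history_forcing]. *)
Definition history_forcing (R : realType) (alpha tau : R) (phi : R -> R)
    (t : R) : R :=
  caputo alpha 0 phi t - caputo alpha (- tau) phi t.

Definition modified_delay_solution (R : realType) (alpha tau : R)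
    (lambda : R[i]) (phi f : R -> R) (u : R -> R[i]) : Prop :=
  delay_solution alpha tau lambda phi
    (fun t => f t + history_forcing alpha tau phi t) u.

(* Main.v *)
(* The difference w = yhat - y vanishes on [-tau, 0] and satisfies, for t >= 0,
     w = J^alpha (lambda w(. - tau) + c),  c = (y0 / tau) (g - g(. + tau)),
   where J^b is the convolution with the Abel kernel K_b(x) = x^(b-1) / Gamma(b)
   on x > 0 and g = K_(2 - alpha).  The method of steps gives
     w(t) = sum_k lambda^k (J^((k+1) alpha) c)(t - k tau),
   thanks to the semigroup law K_a * K_b = K_(a+b), which follows from the
   associativity of convolution and B(a, b) Gamma(a + b) = Gamma(a) Gamma(b).
   Finally J^((k+1) alpha) g = K_(alpha k + 2), while the delayed part of c
   leads to a beta integral over [tau / (s + tau), 1], i.e. to an incomplete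
   beta function. *)

Require Import Defs.
From mathcomp Require Import all_boot all_order all_algebra.
From mathcomp Require Import complex.
From mathcomp Require Import all_classical all_reals all_analysis.
From mathcomp Require Import measurable_realfun ring lra.

Import Order.TTheory GRing.Theory Num.Theory.
Import numFieldNormedType.Exports.

Local Open Scope classical_set_scope.
Local Open Scope ring_scope.

(** * Lebesgue integrals under affine maps, and convolution *)

(** [Rintegral] returns a real number even for a non-integrable function, so working with it
    directly would require integrability proofs at every exchange or splitting of integrals, for
    kernels that may be singular at the origin. The kernels are therefore nonnegative, extended by
    zero to the whole line, and convolved with values in the extended reals. Tonelli's theorem and
    the behaviour of Lebesgue measure under affine maps then suffice, and integrability on bounded
    intervals is read off afterwards from the finite value of a convolution. The forcing is a
    difference of two such kernels; each is propagated separately, so that no indeterminate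
    difference of infinities can occur. The difference of the solutions is computed by induction
    directly from the two integral equations. *)

Section lebesgue_invariance.
Context {R : realType}.
Notation mu := (@lebesgue_measure R).
Local Open Scope ereal_scope.
Implicit Types f : R -> \bar R.

(** Lebesgue measure is determined by its values on half-open intervals, and a translation preserves
    their lengths. *)
Lemma lebesgue_measure_shift (d : R) (A : set R) : measurable A ->
  pushforward mu (fun x : measurableTypeR R => (x + d)%R : measurableTypeR R) A
  = mu A.
Proof.
pose phi (x : measurableTypeR R) : measurableTypeR R := (x + d)%R.
have mphi : measurable_fun setT phi by exact: measurable_funD.
pose nu := (pushforward mu phi : {measure set (measurableTypeR R) -> \bar R}).
move=> mA; apply/esym.
apply: (@lebesgue_measure_unique R (nu mphi)) => //.
move=> _ [[a b]] _ <-; rewrite /nu /=.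
rewrite [RHS](_ : _ = mu `](a - d)%R, (b - d)%R]%classic); last first.
  congr (mu _).
  by apply/seteqP; split => x /=; rewrite !in_itv/= ltrBlDr lerBrDr.
rewrite !lebesgue_measure_itv/= !lte_fin ltrD2r -!EFinB.
by case: ifP => // _; congr EFin; ring.
Qed.

Lemma lebesgue_measure_scale (c : R) (c0 : (0 < c)%R) (A : set R) :
  measurable A ->
  pushforward mu (fun x : measurableTypeR R => (c * x)%R : measurableTypeR R) A
  = c^-1%:E * mu A.
Proof.
pose phi (x : measurableTypeR R) : measurableTypeR R := (c * x)%R.
have mphi : measurable_fun setT phi by exact: measurable_funM.
(* The factor [c] compensates for the contraction of lengths in preimages under multiplication by
   [c], so that uniqueness applies to [nu]. *)
pose nu := (mscale (NngNum (ltW c0)) (pushforward mu phi) :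
  {measure set (measurableTypeR R) -> \bar R}).
move=> mA.
suff <- : nu mphi A = mu A.
  by rewrite /nu /mscale/= muleA -EFinM mulVf ?gt_eqF// mul1e.
apply/esym.
apply: (@lebesgue_measure_unique R (nu mphi)) => //.
move=> _ [[a b]] _ <-; rewrite /nu /mscale /=.
rewrite [RHS](_ : _ = c%:E * mu `](a / c)%R, (b / c)%R]%classic); last first.
  congr (_ * mu _).
  apply/seteqP; split => x /=; rewrite !in_itv/= ltr_pdivrMr// ler_pdivlMr//;
  by rewrite mulrC.
rewrite !lebesgue_measure_itv/= !lte_fin ltr_pM2r ?invr_gt0// -!EFinB.
case: ifP => //; last by rewrite mule0.
by rewrite -EFinM => _; congr EFin; field; rewrite gt_eqF.
Qed.

Lemma ge0_integral_shift f (d : R) :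
  measurable_fun setT f -> (forall x, 0 <= f x) ->
  \int[mu]_x f (x + d)%R = \int[mu]_x f x.
Proof.
move=> mf f0.
pose phi : measurableTypeR R -> measurableTypeR R := fun x => (x + d)%R.
have mphi : measurable_fun setT phi by exact: measurable_funD.
have := @ge0_integral_pushforward _ _ _ _ R phi mphi mu setT f measurableT mf
  (fun y _ => f0 y).
rewrite preimage_setT => /= <-.
by apply: eq_measure_integral => //= A mA AS; exact: lebesgue_measure_shift.
Qed.

Lemma ge0_integral_scale f (c : R) : (0 < c)%R ->
  measurable_fun setT f -> (forall x, 0 <= f x) ->
  \int[mu]_x f (c * x)%R = c^-1%:E * \int[mu]_x f x.
Proof.
move=> c0 mf f0.
pose phi : measurableTypeR R -> measurableTypeR R := fun x => (c * x)%R.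
have mphi : measurable_fun setT phi by exact: measurable_funM.
have := @ge0_integral_pushforward _ _ _ _ R phi mphi mu setT f measurableT mf
  (fun y _ => f0 y).
rewrite preimage_setT => /= <-.
have ci0 : (0 <= c^-1)%R by rewrite invr_ge0 ltW.
rewrite -(@ge0_integral_mscale _ _ _ mu _ measurableT (NngNum ci0) f)//.
by apply: eq_measure_integral => //= A mA AS; exact: lebesgue_measure_scale.
Qed.

End lebesgue_invariance.

Section convolution.
Context {R : realType}.
Notation mu := (@lebesgue_measure R).
Local Open Scope ereal_scope.
Implicit Types f g h : R -> \bar R.

(** The integral runs over the whole line; for factors that vanish at negative arguments, only s
    between 0 and t contributes. *)
Definition conv f g (t : R) : \bar R := \int[mu]_s (f (t - s)%R * g s).

Lemma conv_ge0 f g t : (forall x, 0 <= f x) -> (forall x, 0 <= g x) ->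
  0 <= conv f g t.
Proof. by move=> f0 g0; apply: integral_ge0 => s _; rewrite mule_ge0. Qed.

Lemma measurable_comp_subl f (c : R) :
  measurable_fun setT f -> measurable_fun setT (fun x : R => f (c - x)%R).
Proof. by move=> mf; apply: (measurableT_comp mf); exact: measurable_funB. Qed.

Lemma measurable_comp_subr f (c : R) :
  measurable_fun setT f -> measurable_fun setT (fun x : R => f (x - c)%R).
Proof. by move=> mf; apply: (measurableT_comp mf); exact: measurable_funB. Qed.

Lemma measurable_conv_integrand f g :
  measurable_fun setT f -> measurable_fun setT g ->
  measurable_fun setT (fun z : measurableTypeR R * measurableTypeR R =>
    f (z.1 - z.2)%R * g z.2).
Proof.
move=> mf mg; apply: emeasurable_funM.
  apply: (measurableT_comp mf).
  exact: (measurable_funB measurable_fst measurable_snd).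
exact: (measurableT_comp mg).
Qed.

Lemma measurable_conv f g :
  measurable_fun setT f -> measurable_fun setT g ->
  (forall x, 0 <= f x) -> (forall x, 0 <= g x) ->
  measurable_fun setT (conv f g).
Proof.
move=> mf mg f0 g0.
apply: (@measurable_fun_fubini_tonelli_F _ _ (measurableTypeR R)
  (measurableTypeR R) R mu (fun z => f (z.1 - z.2)%R * g z.2)).
  exact: measurable_conv_integrand.
by move=> x; rewrite mule_ge0.
Qed.

(** Tonelli exchanges the two integrals, and translating the inner variable by r exposes the
    convolution of [f] and [g] at t - r. *)
Lemma conv_assoc f g h t :
  measurable_fun setT f -> measurable_fun setT g -> measurable_fun setT h ->
  (forall x, 0 <= f x) -> (forall x, 0 <= g x) -> (forall x, 0 <= h x) ->
  conv f (conv g h) t = conv (conv f g) h t.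
Proof.
move=> mf mg mh f0 g0 h0; rewrite /conv.
transitivity (\int[mu]_s \int[mu]_r (f (t - s)%R * (g (s - r)%R * h r))).
  apply: eq_integral => s _; rewrite ge0_integralZl//.
  - exact: (emeasurable_funM (measurable_comp_subl _ s mg) mh).
  - by move=> r _; rewrite mule_ge0.
rewrite (@fubini_tonelli _ _ (measurableTypeR R) (measurableTypeR R) R mu mu
  (fun z => f (t - z.1)%R * (g (z.1 - z.2)%R * h z.2)))/=; first last.
- by move=> z; rewrite !mule_ge0.
- apply: emeasurable_funM; last exact: measurable_conv_integrand.
  exact: (measurableT_comp (measurable_comp_subl _ t mf)).
apply: eq_integral => r _.
under eq_integral do rewrite muleA.
rewrite ge0_integralZr//; last 2 first.
- exact: (emeasurable_funM (measurable_comp_subl _ t mf)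
    (measurable_comp_subr _ r mg)).
- by move=> s _; rewrite mule_ge0.
congr (_ * _).
rewrite -(@ge0_integral_shift _ _ r).
- by apply: eq_integral => s _; congr (f _ * g _); ring.
- exact: (emeasurable_funM (measurable_comp_subl _ t mf)
    (measurable_comp_subr _ r mg)).
- by move=> s; rewrite mule_ge0.
Qed.

(** After Tonelli, translation invariance makes the inner integral independent of s. This is the
    source of the product of two Gamma values. *)
Lemma integral_conv f g :
  measurable_fun setT f -> measurable_fun setT g ->
  (forall x, 0 <= f x) -> (forall x, 0 <= g x) ->
  \int[mu]_t conv f g t = (\int[mu]_x f x) * \int[mu]_x g x.
Proof.
move=> mf mg f0 g0; rewrite /conv.
rewrite (@fubini_tonelli _ _ (measurableTypeR R) (measurableTypeR R) R mu mu
  (fun z => f (z.1 - z.2)%R * g z.2))/=; first last.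
- by move=> z; rewrite mule_ge0.
- exact: measurable_conv_integrand.
rewrite -ge0_integralZl//; last by apply: integral_ge0.
apply: eq_integral => s _; rewrite ge0_integralZr//; last first.
  exact: measurable_comp_subr.
by rewrite (@ge0_integral_shift _ _ (- s)%R).
Qed.

Lemma conv_shiftr f g d t :
  measurable_fun setT f -> measurable_fun setT g ->
  (forall x, 0 <= f x) -> (forall x, 0 <= g x) ->
  conv f (fun x => g (x - d)%R) t = conv f g (t - d)%R.
Proof.
move=> mf mg f0 g0; rewrite /conv -[RHS](@ge0_integral_shift _ _ (- d)%R).
- by apply: eq_integral => s _; congr (f _ * _); ring.
- exact: (emeasurable_funM (measurable_comp_subl _ _ mf) mg).
- by move=> s; rewrite mule_ge0.
Qed.

Lemma conv_scale f g c t : (0 < c)%R ->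
  measurable_fun setT f -> measurable_fun setT g ->
  (forall x, 0 <= f x) -> (forall x, 0 <= g x) ->
  conv f g (c * t)%R = c%:E * conv (fun x => f (c * x)%R) (fun x => g (c * x)%R) t.
Proof.
move=> c0 mf mg f0 g0; rewrite /conv.
rewrite (_ : \int[mu]_s (f (c * (t - s))%R * g (c * s)%R) =
    c^-1%:E * \int[mu]_s (f (c * t - s)%R * g s)); last first.
  under eq_integral do rewrite mulrBr.
  rewrite -ge0_integral_scale//.
- exact: (emeasurable_funM (measurable_comp_subl _ _ mf) mg).
- by move=> s; rewrite mule_ge0.
by rewrite muleA -EFinM mulfV ?gt_eqF// mul1e.
Qed.

End convolution.

(** * The Euler integrals *)

Section euler_integrals.
Context {R : realType}.
Notation mu := (@lebesgue_measure R).
Implicit Types a b x t : R.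

Lemma derive_powR_div a x : 0 < a -> 0 < x ->
  is_derive x 1 (fun y : R => a^-1 * y `^ a) (x `^ (a - 1)).
Proof.
move=> a0 x0.
have := is_deriveZ a^-1 (is_derive1_powR a x0).
by rewrite /GRing.scale/= mulrA mulVf ?gt_eqF// mul1r.
Qed.

Lemma continuous_powR_gt0 a x : 0 < x -> {for x, continuous (@powR R ^~ a)}.
Proof.
move=> x0; apply/differentiable_continuous/derivable1_diffP.
by apply: derivable_powR; rewrite in_itv/= x0.
Qed.

Lemma integral_powR_le a : 0 < a ->
  (\int[mu]_(x in `]0%R, 1%R]) (x `^ (a - 1))%:E <= (a^-1)%:E)%E.
Proof.
move=> a0.
(* The power may be unbounded at 0, so ]0, 1] is exhausted by segments on which the fundamental
   theorem of calculus applies; [n.+2] keeps the lower end strictly below 1. *)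
pose F n : set R := `[n.+2%:R^-1, 1]%classic.
have -> : `]0, 1]%classic = \bigcup_n F n.
  apply/seteqP; split => x /=; last first.
    move=> [n _]; rewrite /F/= !in_itv/= => /andP[+ ->]; rewrite andbT.
    by apply: lt_le_trans; rewrite invr_gt0.
  rewrite in_itv/= => /andP[x0 x1].
  exists (Num.truncn x^-1) => //; rewrite /F/= in_itv/= x1 andbT.
  rewrite -[leRHS]invrK lef_pV2 ?posrE ?invr_gt0//.
  apply: ltW; apply: lt_trans (truncnS_gt _) _.
  by rewrite ltr_nat.
have mF i : measurable_fun (F i) (fun x => (x `^ (a - 1))%:E).
  by apply/measurable_EFinP; apply: measurable_funTS; exact: measurable_powR.
have cF : (\int[mu]_(x in F i) (x `^ (a - 1))%:E)%E @[i --> \oo] -->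
   (\int[mu]_(x in \bigcup_i F i) (x `^ (a - 1))%:E)%E.
  apply: ge0_nondecreasing_set_cvg_integral.
  - move=> n m nm; apply/subsetPset => x; rewrite /F/= !in_itv/=.
    move=> /andP[+ ->]; rewrite andbT; apply: le_trans.
    by rewrite lef_pV2 ?posrE// ler_nat !ltnS.
  - by move=> i; exact: measurable_itv.
  - exact: mF.
  - by move=> i x _; rewrite lee_fin powR_ge0.
apply: (cvge_to_le cF).
near=> n.
have n0 : (0 : R) < n.+2%:R^-1 by rewrite invr_gt0.
rewrite /F (@continuous_FTC2 _ _ (fun y => a^-1 * y `^ a)).
- rewrite powR1 mulr1 -EFinB lee_fin gerBl mulr_ge0 ?powR_ge0//.
  by rewrite invr_ge0 ltW.
- by rewrite invf_lt1// ltr1n.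
- apply: continuous_in_subspaceT => x /set_mem/=; rewrite in_itv/= => /andP[x0 _].
  by apply: continuous_powR_gt0; exact: lt_le_trans x0.
- split.
  + move=> x; rewrite in_itv/= => /andP[x0 _].
    by have [] := derive_powR_div a x a0 (lt_trans n0 x0).
  + apply: cvg_at_right_filter; apply: cvgM; first exact: cvg_cst.
    exact: continuous_powR_gt0.
  + apply: cvg_at_left_filter; apply: cvgM; first exact: cvg_cst.
    exact: continuous_powR_gt0.
- move=> x; rewrite in_itv/= => /andP[x0 _].
  by have [_] := derive_powR_div a x a0 (lt_trans n0 x0); rewrite derive1E.
Unshelve. all: by end_near. Qed.

(** The explicit cut is needed because [powR] does not vanish at negative bases. *)
Definition powp a x : R := if 0 < x then x `^ (a - 1) else 0.

Lemma powp_ge0 a x : 0 <= powp a x.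
Proof. by rewrite /powp; case: ifP => // _; exact: powR_ge0. Qed.

Lemma measurable_powp a : measurable_fun setT (powp a).
Proof.
apply: measurable_fun_ifT.
- exact: measurable_fun_ltr.
- exact: measurable_powR.
- exact: measurable_cst.
Qed.

Definition gamma_ext a : \bar R := (\int[mu]_x (powp a x * expR (- x))%:E)%E.

Lemma euler_gammaE a : euler_gamma a = fine (gamma_ext a).
Proof.
rewrite /euler_gamma Rintegral_mkcond /Rintegral; congr fine.
apply: eq_integral => x _; congr EFin; rewrite patchE /powp.
case: ifPn => [/set_mem/=|]; first by rewrite in_itv/= andbT => ->.
by rewrite notin_setE/= in_itv/= andbT => /negP/negbTE->; rewrite mul0r.
Qed.

Lemma measurable_gamma_integrand a :
  measurable_fun setT (fun x => powp a x * expR (- x)).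
Proof.
apply: measurable_funM; first exact: measurable_powp.
by apply: measurableT_comp => //; exact: measurable_expR.
Qed.

Lemma gamma_ext_ge0 a : (0 <= gamma_ext a)%E.
Proof.
by apply: integral_ge0 => x _; rewrite lee_fin mulr_ge0 ?powp_ge0 ?expR_ge0.
Qed.

(* [ln] lies below its tangent at [2a], so that x^a e^(-x) <= (2a)^a e^(-x/2). *)
Lemma powR_expR_le a x : 0 < a -> 1 <= x ->
  x `^ (a - 1) * expR (- x) <= (a *+ 2) `^ a * expR (- (x / 2)).
Proof.
move=> a0 x1.
have x0 : 0 < x by exact: lt_le_trans x1.
have a20 : 0 < a *+ 2 by rewrite mulrn_wgt0.
apply: (@le_trans _ _ (x `^ a * expR (- x))).
  rewrite ler_wpM2r ?expR_ge0//; apply: ler_powR => //.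
  by rewrite gerBl.
rewrite /powR !gt_eqF// -!expRD ler_expR.
have : ln (x / (a *+ 2)) <= x / (a *+ 2) - 1.
  have := @le_ln1Dx _ (x / (a *+ 2) - 1).
  rewrite (addrC 1) subrK; apply.
  by rewrite ltrBrDr addNr divr_gt0.
rewrite ln_div ?posrE// => h.
have : a * (ln x - ln (a *+ 2)) <= a * (x / (a *+ 2) - 1).
  by rewrite ler_pM2l.
have -> : a * (x / (a *+ 2) - 1) = x / 2 - a.
  by rewrite -mulr_natl; field; rewrite gt_eqF.
by move=> {}h; lra.
Qed.

(** The integrand is dominated by the power alone on ]0, 1] and, beyond 1, by a multiple of the
    exponential density of rate 1/2. *)
Lemma gamma_ext_lty a : 0 < a -> (gamma_ext a < +oo)%E.
Proof.
move=> a0.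
(* The last factor 2 cancels the rate 1/2 in front of the exponential density. *)
pose C := (a *+ 2) `^ a *+ 2.
have C0 : 0 <= C by rewrite mulrn_wge0// powR_ge0.
pose f1 x : \bar R := (((fun x => x `^ (a - 1)) \_ `]0, 1]) x)%:E.
pose f2 x : \bar R := (C%:E * (exponential_pdf 2^-1 x)%:E)%E.
have f10 x : (0 <= f1 x)%E.
  by rewrite lee_fin patchE; case: ifP => // _; exact: powR_ge0.
have mf1 : measurable_fun setT f1.
  apply/measurable_EFinP/(measurable_restrictT _ _).1 => //.
  by apply: measurable_funTS; exact: measurable_powR.
have e0 x : 0 <= exponential_pdf (2^-1 : R) x by exact: exponential_pdf_ge0.
have f20 x : (0 <= f2 x)%E by rewrite mule_ge0 ?lee_fin.
have me : measurable_fun setT (fun x => (exponential_pdf (2^-1 : R) x)%:E).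
  by apply/measurable_EFinP; exact: measurable_exponential_pdf.
have mf2 : measurable_fun setT f2 by exact: measurable_funeM.
apply: (@le_lt_trans _ _ (\int[mu]_x (f1 x + f2 x))%E).
  apply: ge0_le_integral => //.
  - by move=> x _; rewrite lee_fin mulr_ge0 ?powp_ge0 ?expR_ge0.
  - by apply/measurable_EFinP; exact: measurable_gamma_integrand.
  - exact: emeasurable_funD.
  - move=> x _; rewrite /powp; case: ifP => x0; last first.
      by rewrite mul0r adde_ge0.
    have [x1|x1] := leP x 1.
      apply: (@le_trans _ _ (f1 x)); last by rewrite leeDl.
      rewrite lee_fin patchE mem_set/= ?in_itv/= ?x0//.
      by rewrite ler_piMr ?powR_ge0// -expR0 ler_expR oppr_le0 ltW.
    apply: (@le_trans _ _ (f2 x)); last by rewrite leeDr.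
    rewrite /f2 -EFinM lee_fin exponential_pdfE; last exact: ltW.
    apply: le_trans (powR_expR_le a x a0 (ltW x1)) _.
    rewrite /C (_ : - (x / 2) = - 2^-1 * x); last by field.
    rewrite (_ : _ *+ 2 * _ = (a *+ 2) `^ a * expR (- 2^-1 * x))//.
    by rewrite -[_ `^ _ *+ 2]mulr_natr; field.
rewrite ge0_integralD//.
apply: lte_add_pinfty.
  apply: le_lt_trans (ltry a^-1).
  apply: le_trans (integral_powR_le a a0).
  rewrite (_ : (\int[mu]_x f1 x = \int[mu]_(x in `]0%R, 1%R]) (x `^ (a - 1))%:E)%E)//.
  rewrite [RHS]integral_mkcond; apply: eq_integral => x _.
  by rewrite /f1 !patchE; case: ifP.
rewrite ge0_integralZl//.
  by rewrite integral_exponential_pdf ?invr_gt0// mule1 ltry.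
by move=> x _; rewrite lee_fin.
Qed.

Lemma gamma_ext_gt0 a : 0 < a -> (0 < gamma_ext a)%E.
Proof.
(* On [1, 2] the power is at least 1/x, hence at least 1/2, and the exponential is at least
   e^(-2). *)
move=> a0; pose c : R := 2^-1 * expR (- 2).
have c0 : 0 < c by rewrite mulr_gt0 ?invr_gt0 ?expR_gt0.
apply: (@lt_le_trans _ _ (\int[mu]_(x in `[1%R, 2%R]) c%:E)%E).
  rewrite integral_cst//= lebesgue_measure_itv/= lte_fin ltr1n -EFinB -EFinM.
  by rewrite lte_fin mulr_gt0// subr_gt0 ltr1n.
rewrite integral_mkcond; apply: ge0_le_integral => //.
- by move=> x _; rewrite patchE; case: ifP => // _; rewrite lee_fin ltW.
- exact/(measurable_restrictT _ _).1.
- by apply/measurable_EFinP; exact: measurable_gamma_integrand.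
move=> x _; rewrite patchE; case: ifPn => [/set_mem/=|_]; last first.
  by rewrite lee_fin mulr_ge0 ?powp_ge0 ?expR_ge0.
rewrite in_itv/= => /andP[x1 x2].
have x0 : 0 < x by exact: lt_le_trans x1.
rewrite lee_fin /powp x0 ler_pM ?invr_ge0 ?expR_ge0//; last first.
  by rewrite ler_expR lerN2.
apply: (@le_trans _ _ (x `^ (- 1))).
  by rewrite powR_inv1 ?(ltW x0)// lef_pV2 ?posrE.
by apply: ler_powR => //; rewrite lerBrDr addNr ltW.
Qed.

Lemma euler_gamma_gt0 a : 0 < a -> 0 < euler_gamma a.
Proof.
by move=> a0; rewrite euler_gammaE fine_gt0// gamma_ext_gt0//= gamma_ext_lty.
Qed.

Lemma gamma_extE a : 0 < a -> gamma_ext a = (euler_gamma a)%:E.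
Proof.
move=> a0; rewrite euler_gammaE fineK// ge0_fin_numE ?gamma_ext_lty//.
exact: gamma_ext_ge0.
Qed.

(** Away from 0 the integrand is the exponential density of rate 1, whose total mass is 1. *)
Lemma euler_gamma1 : euler_gamma (1 : R) = 1.
Proof.
rewrite euler_gammaE.
have <- : (\int[mu]_x (exponential_pdf (1 : R) x)%:E)%E = gamma_ext 1.
  have mg : measurable_fun setT (fun x : R => powp 1 x * expR (- x)).
    exact: measurable_gamma_integrand.
  rewrite /gamma_ext.
  apply: ae_eq_integral => //.
  - by apply/measurable_EFinP; exact: measurable_exponential_pdf.
  - exact/measurable_EFinP.
  exists [set 0]; split => //; first exact: lebesgue_measure_set1.
  move=> x /= h; apply: contrapT => /eqP x0; apply: h => _; congr EFin.
  rewrite /powp; case: ltrgt0P x0 => // x0 _.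
    by rewrite exponential_pdfE ?ltW// subrr powRr0 mulN1r.
  by rewrite lt0_exponential_pdf// mul0r.
by rewrite integral_exponential_pdf.
Qed.

End euler_integrals.

(** * The convolution semigroup of the Abel kernels *)

#[local] Opaque euler_gamma.

Section abel_kernel.
Context {R : realType}.
Notation mu := (@lebesgue_measure R).
Implicit Types a b c x s t : R.

Lemma powp_scale c a x : 0 < c -> powp a (c * x) = c `^ (a - 1) * powp a x.
Proof.
move=> c0; rewrite /powp pmulr_rgt0//; case: ifP => x0; last by rewrite mulr0.
by rewrite powRM ?ltW.
Qed.

(** This is Euler's beta integral, with the exponent b - 1 on the variable and a - 1 on its
    complement to 1. *)
Definition beta_ext a b : \bar R := conv (EFin \o powp a) (EFin \o powp b) 1.

Let mpowp a : measurable_fun setT (EFin \o powp a : R -> \bar R).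
Proof. by apply/measurable_EFinP; exact: measurable_powp. Qed.

Let powp0 a x : (0 <= (EFin \o powp a) x)%E.
Proof. by rewrite lee_fin powp_ge0. Qed.

Lemma beta_ext_ge0 a b : (0 <= beta_ext a b)%E.
Proof. exact: conv_ge0. Qed.

(** Homogeneity reduces a positive t to 1 by scaling. For t <= 0 the arguments t - s and s are never
    both positive, so the integrand vanishes. *)
Lemma conv_powp a b t :
  conv (EFin \o powp a) (EFin \o powp b) t =
  (beta_ext a b * (powp (a + b) t)%:E)%E.
Proof.
have [t0|t0] := ltP 0 t; last first.
  rewrite [powp _ t]/powp ltNge t0 mule0 /conv; apply: integral0_eq => s _ /=.
  rewrite -EFinM /powp; case: ifP => ts; last by rewrite mul0r.
  case: ifP => s0; last by rewrite mulr0.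
  by move: t0; rewrite leNgt -(subrK s t) addr_gt0.
rewrite -{1}(mulr1 t) conv_scale//.
rewrite (_ : conv _ _ 1 = (t `^ (a - 1) * t `^ (b - 1))%:E * beta_ext a b)%E.
  rewrite muleA -EFinM muleC; congr (_ * _%:E)%E.
  rewrite /powp t0 -powRD ?(gt_eqF t0) ?implybT//.
  rewrite -[X in X * _](powRr1 (ltW t0)) -powRD ?(gt_eqF t0) ?implybT//.
  by congr powR; ring.
rewrite /beta_ext /conv -ge0_integralZl//.
- apply: eq_integral => s _ /=; rewrite !powp_scale// -!EFinM.
  by congr EFin; ring.
- exact: (emeasurable_funM (measurable_comp_subl _ _ (mpowp a)) (mpowp b)).
- by move=> s _; rewrite mule_ge0.
- by rewrite lee_fin mulr_ge0 ?powR_ge0.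
Qed.

(** Since e^(-(t - s)) e^(-s) = e^(-t), the convolution of two Gamma integrands is the convolution
    of the powers times e^(-t); integrating it over t gives both sides. *)
Lemma gamma_beta_ext a b :
  (gamma_ext a * gamma_ext b = beta_ext a b * gamma_ext (a + b))%E.
Proof.
pose f c : R -> \bar R := EFin \o (fun x => powp c x * expR (- x)).
have mf c : measurable_fun setT (f c).
  by apply/measurable_EFinP; exact: measurable_gamma_integrand.
have f0 c x : (0 <= f c x)%E by rewrite lee_fin mulr_ge0 ?powp_ge0 ?expR_ge0.
have := integral_conv (f a) (f b) (mf a) (mf b) (f0 a) (f0 b).
rewrite -[X in X = _ -> _](_ : (beta_ext a b * gamma_ext (a + b))%E = _).
  by rewrite /gamma_ext => ->.
rewrite /gamma_ext -ge0_integralZl//; last 3 first.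
- exact: mf.
- by move=> x _; exact: f0.
- exact: beta_ext_ge0.
apply: eq_integral => t _.
rewrite EFinM muleA -conv_powp /conv -ge0_integralZr//.
- apply: eq_integral => s _ /=; rewrite -!EFinM; congr EFin.
  rewrite mulrACA -expRD (_ : - (t - s) - s = - t) ?mulrA//; ring.
- exact: (emeasurable_funM (measurable_comp_subl _ _ (mpowp a)) (mpowp b)).
- by move=> s _; rewrite mule_ge0.
Qed.

Lemma beta_extE a b : 0 < a -> 0 < b ->
  beta_ext a b = (euler_gamma a * euler_gamma b / euler_gamma (a + b))%:E.
Proof.
move=> a0 b0; have := gamma_beta_ext a b.
have ab0 : 0 < euler_gamma (a + b) by rewrite euler_gamma_gt0 ?addr_gt0.
rewrite !gamma_extE ?addr_gt0// => h.
by rewrite EFinM EFinM h -muleA -EFinM mulfV ?gt_eqF// mule1.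
Qed.

Definition abel_kernel a x : R := powp a x / euler_gamma a.
Local Notation K := abel_kernel.

Lemma abel_kernel_ge0 a x : 0 < a -> 0 <= K a x.
Proof. by move=> a0; rewrite divr_ge0 ?powp_ge0// ltW// euler_gamma_gt0. Qed.

Lemma measurable_abel_kernel a : measurable_fun setT (K a).
Proof. by apply: measurable_funM => //; exact: measurable_powp. Qed.

Lemma measurable_EFin_abel_kernel a : measurable_fun setT (EFin \o K a).
Proof. by apply/measurable_EFinP; exact: measurable_abel_kernel. Qed.

Lemma abel_kernel_scale c a x : 0 < c -> K a (c * x) = c `^ (a - 1) * K a x.
Proof. by move=> c0; rewrite /K powp_scale// mulrA. Qed.

Lemma conv_abel_kernel a b t : 0 < a -> 0 < b ->
  conv (EFin \o K a) (EFin \o K b) t = (K (a + b) t)%:E.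
Proof.
move=> a0 b0.
transitivity (conv (EFin \o powp a) (EFin \o powp b) t *
    ((euler_gamma a)^-1 * (euler_gamma b)^-1)%:E)%E.
  rewrite /conv /abel_kernel.
  have: 0 <= (euler_gamma b)^-1 by rewrite invr_ge0 ltW// euler_gamma_gt0.
  have: 0 <= (euler_gamma a)^-1 by rewrite invr_ge0 ltW// euler_gamma_gt0.
  move: (euler_gamma a)^-1 (euler_gamma b)^-1 => A B A0 B0.
  rewrite -ge0_integralZr//.
  - by apply: eq_integral => s _ /=; rewrite -!EFinM mulrACA.
  - exact: (emeasurable_funM (measurable_comp_subl _ _ (mpowp a)) (mpowp b)).
  - by move=> s _; rewrite mule_ge0.
  - by rewrite lee_fin mulr_ge0.
rewrite conv_powp beta_extE// -!EFinM; congr EFin; rewrite /abel_kernel.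
have := euler_gamma_gt0 (a + b) (addr_gt0 a0 b0).
have := euler_gamma_gt0 b b0; have := euler_gamma_gt0 a a0.
move: (euler_gamma a) (euler_gamma b) (euler_gamma _) (powp _ _) => A B C p.
by move=> A0 B0 C0; field; rewrite !gt_eqF.
Qed.

Let beta_integrand a b (r : R) : \bar R := (powp b (1 - r) * powp a r)%:E.

Let beta_integrand_ge0 a b r : (0 <= beta_integrand a b r)%E.
Proof. by rewrite lee_fin mulr_ge0 ?powp_ge0. Qed.

Let measurable_beta_integrand a b : measurable_fun setT (beta_integrand a b).
Proof.
exact: (emeasurable_funM (measurable_comp_subl _ _ (mpowp b)) (mpowp a)).
Qed.

(** With the cut-off integrand, cutting the beta integral at x amounts to cutting the line at x. The
    end points, where [powR] and [powp] may disagree, form a null set. *)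
Lemma beta_integral_itv a b x : x <= 1 ->
  \int[mu]_(r in `[0, x]) (r `^ (a - 1) * (1 - r) `^ (b - 1)) =
  fine (\int[mu]_(r in `]-oo, x[) beta_integrand a b r)%E.
Proof.
move=> x1; rewrite /Rintegral; congr fine.
transitivity (\int[mu]_(r in `[0%R, x]) beta_integrand a b r)%E.
  apply: eq_integral_itv_bounded.
  - apply: measurable_funTS; apply: measurable_funM.
      exact: measurable_powR.
    by apply: (measurableT_comp (measurable_powR _)); exact: measurable_funB.
  - apply: measurable_funTS; apply/measurable_EFinP.
    exact: (measurable_beta_integrand a b).
  - move=> r; rewrite in_itv/= => /andP[r0 rx]; rewrite /powp r0 subr_gt0.
    by rewrite (lt_le_trans rx x1) mulrC.
rewrite -integral_itv_bndo_bndc; last first.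
  by apply: measurable_funTS; exact: measurable_beta_integrand.
rewrite integral_mkcond [RHS]integral_mkcond; apply: eq_integral => r _.
rewrite !patchE !mem_setE !in_itv/=.
case: (leP 0 r) => //= r0.
by rewrite /beta_integrand [X in _ * X]/powp (ltNge 0) (ltW r0) mulr0; case: ifP.
Qed.

Lemma euler_betaE a b : 0 < a -> 0 < b ->
  euler_beta a b = euler_gamma a * euler_gamma b / euler_gamma (a + b).
Proof.
move=> a0 b0; rewrite /euler_beta beta_integral_itv//.
rewrite (_ : integral _ _ _ = beta_ext b a).
  by rewrite (beta_extE _ _ b0 a0)/= (addrC b) (mulrC (euler_gamma b)).
rewrite integral_mkcond /beta_ext /conv; apply: eq_integral => r _.
rewrite patchE mem_setE in_itv/=; case: leP => //= r1.
by rewrite /powp subr_gt0 ltNge r1/= mul0e.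
Qed.

(* Substituting r + tau = (s + tau) q turns the convolution into the part of the
   beta integral over [tau / (s + tau), 1]. *)
Lemma conv_abel_kernel_trunc a b tau s : 0 < a -> 0 < b -> 0 < tau -> 0 <= s ->
  conv (EFin \o K b) (fun r => (if 0 <= r then K a (r + tau) else 0)%:E) s =
  ((s + tau) `^ (a + b - 1) / euler_gamma (a + b) *
   (1 - incomplete_beta (tau / (s + tau)) a b))%:E.
Proof.
move=> a0 b0 tau0 s0; pose T := s + tau.
have T0 : 0 < T by rewrite ltr_wpDl.
have x1 : tau / T <= 1 by rewrite ler_pdivrMr// mul1r lerDr.
have ga := euler_gamma_gt0 a a0; have gb := euler_gamma_gt0 b b0.
have gab : 0 < euler_gamma (a + b) by rewrite euler_gamma_gt0 ?addr_gt0.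
pose h c r : \bar R := (if c <= r then K a r else 0)%:E.
have h0 c r : (0 <= h c r)%E.
  by rewrite lee_fin; case: ifP => // _; exact: abel_kernel_ge0.
have mh c : measurable_fun setT (h c).
  apply/measurable_EFinP; apply: measurable_fun_ifT.
  - exact: measurable_fun_ler.
  - exact: measurable_abel_kernel.
  - exact: measurable_cst.
have mKb := measurable_EFin_abel_kernel b.
have Kb0 r : (0 <= (EFin \o K b) r)%E by rewrite lee_fin abel_kernel_ge0.
(* The delayed kernel is the kernel cut at [tau], translated by [- tau]. Translation moves the
   evaluation point to [T], and scaling by [T] moves it to 1 and the cut to [tau / T]. *)
rewrite (_ : (fun r => (if 0 <= r then K a (r + tau) else 0)%:E) =
    (fun r => h tau (r - - tau))); last first.
  by apply/funext => r; rewrite /h opprK lerDr.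
rewrite (conv_shiftr _ _ (- tau) s mKb (mh tau) Kb0 (h0 tau)) opprK -/T.
rewrite -[X in conv _ _ X]mulr1 (conv_scale _ _ T 1 T0 mKb (mh tau) Kb0 (h0 tau)).
rewrite (_ : conv _ _ 1 = (T `^ (b - 1) * T `^ (a - 1) /
    (euler_gamma a * euler_gamma b))%:E *
    \int[mu]_(r in `[(tau / T)%R, +oo[) beta_integrand a b r)%E; last first.
  rewrite /conv [in RHS]integral_mkcond -ge0_integralZl//; last 3 first.
  - apply/(measurable_restrictT _ _).1 => //; apply: measurable_funTS.
    exact: measurable_beta_integrand.
  - by move=> r _; rewrite patchE; case: ifP.
  - by rewrite lee_fin divr_ge0 ?mulr_ge0 ?powR_ge0 ?(ltW ga) ?(ltW gb).
  apply: eq_integral => r _; rewrite patchE mem_setE in_itv/= andbT /h.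
  rewrite ler_pdivrMr// (mulrC r); case: ifP => _; last by rewrite !mule0.
  rewrite /= !abel_kernel_scale// -!EFinM /abel_kernel; congr EFin.
  clear -ga gb; move: (powp a _) (powp b _) (euler_gamma a) (euler_gamma b) ga gb.
  by move=> p q A B A0 B0; field; rewrite !gt_eqF.
have : (\int[mu]_(r in `]-oo, (tau / T)%R[) beta_integrand a b r +
    \int[mu]_(r in `[(tau / T)%R, +oo[) beta_integrand a b r =
    (euler_beta a b)%:E)%E.
  rewrite -ge0_integral_setU//; first last.
  - by rewrite disj_set2E; apply/eqP; rewrite -subset0 => r [] /=;
       rewrite !in_itv/= andbT => /lt_le_trans h1 /h1; rewrite ltxx.
  - by apply: measurable_funTS; exact: measurable_beta_integrand.
  rewrite (_ : _ `|` _ = setT); last first.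
    apply/seteqP; split => // r _ /=; rewrite !in_itv/= andbT.
    by case: (ltP r (tau / T)) => _; [left|right].
  by rewrite euler_betaE// (addrC a) (mulrC (euler_gamma a)) -beta_extE.
rewrite /incomplete_beta beta_integral_itv//.
have i10 : (0 <= \int[mu]_(r in `]-oo, (tau / T)%R[) beta_integrand a b r)%E.
  by apply: integral_ge0.
have i20 : (0 <= \int[mu]_(r in `[(tau / T)%R, +oo[) beta_integrand a b r)%E.
  by apply: integral_ge0.
(* Two nonnegative integrals with a finite sum are both finite, so the rest is real algebra. *)
move: (integral _ _ _) i20 i10 => [i2||]//= _; last first.
  by move: (integral _ _ _) => [i1||].
move: (integral _ _ _) => [i1||]//= _ [] hB.
rewrite -!EFinM; congr EFin.
have -> : T * (T `^ (b - 1) * T `^ (a - 1) / (euler_gamma a * euler_gamma b) * i2)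
    = (T * T `^ (b - 1) * T `^ (a - 1)) * (i2 / (euler_gamma a * euler_gamma b)).
  by ring.
rewrite mulr_powRB1 ?(ltW T0)// -powRD ?(gt_eqF T0) ?implybT//.
rewrite (_ : b + (a - 1) = a + b - 1); last by ring.
rewrite -mulrA; congr (_ * _).
move: hB; rewrite euler_betaE// => hB.
have {hB} -> : i2 = euler_gamma a * euler_gamma b / euler_gamma (a + b) - i1.
  by rewrite -hB addrC addrK.
clear -ga gb gab; move: (euler_gamma a) (euler_gamma b) (euler_gamma _) ga gb gab.
by move=> A B C A0 B0 C0; field; rewrite !gt_eqF.
Qed.

End abel_kernel.

(** * Fractional integrals over bounded intervals *)

Section fractional_integral.
Context {R : realType}.
Notation mu := (@lebesgue_measure R).
Notation K := abel_kernel.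
Implicit Types a t r : R.

Lemma measurable_powR_sub a t : measurable_fun setT (fun r : R => (t - r) `^ a).
Proof.
by apply: (measurableT_comp (measurable_powR _)); exact: measurable_funB.
Qed.

(** The kernel vanishes for r >= t and [h] for r < t0, so the convolution lives on [t0, t]; its
    finiteness is exactly the integrability of the nonnegative integrand. *)
Lemma abel_integrable (a t0 t : R) (h : R -> R) (G : R) : 0 < a ->
  measurable_fun setT h -> (forall r, 0 <= h r) -> (forall r, r < t0 -> h r = 0) ->
  conv (EFin \o K a) (EFin \o h) t = G%:E ->
  mu.-integrable `[t0, t] (EFin \o (fun r => (t - r) `^ (a - 1) * h r)) /\
  (euler_gamma a)^-1 * \int[mu]_(r in `[t0, t]) ((t - r) `^ (a - 1) * h r) = G.
Proof.
move=> a0 mh h0 ht0 hG.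
have ga := euler_gamma_gt0 a a0.
have mi : measurable_fun setT (fun r : R => (t - r) `^ (a - 1) * h r).
  by apply: measurable_funM => //; exact: measurable_powR_sub.
have i0 r : 0 <= (t - r) `^ (a - 1) * h r by rewrite mulr_ge0 ?powR_ge0.
have intE : (\int[mu]_(r in `[t0, t]) ((t - r) `^ (a - 1) * h r)%:E)%E =
    (euler_gamma a * G)%:E.
  rewrite EFinM -hG /conv -ge0_integralZl//; last 3 first.
  - exact: (emeasurable_funM (measurable_comp_subl _ _
      (measurable_EFin_abel_kernel a)) (measurableT_comp _ mh)).
  - by move=> r _; rewrite -EFinM lee_fin mulr_ge0 ?abel_kernel_ge0.
  - by rewrite lee_fin ltW.
  pose g r := euler_gamma a * (K a (t - r) * h r).
  transitivity (\int[mu]_(r in `[t0, t]) (g r)%:E)%E.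
    apply: eq_integral_itv_bounded.
    - exact: measurable_funTS.
    - apply: measurable_funTS; apply: measurable_funM => //.
      apply: measurable_funM => //.
      apply: (measurableT_comp (measurable_abel_kernel a)).
      exact: measurable_funB.
    - move=> r; rewrite in_itv/= => /andP[_ rt].
      by rewrite /g /K /powp subr_gt0 rt; field; rewrite gt_eqF.
  rewrite [LHS]integral_mkcond; apply: eq_integral => r _.
  rewrite patchE mem_setE in_itv/= -!EFinM /g.
  case: (leP t0 r) => [_|/ht0 ->] /=; last by rewrite !mulr0.
  case: (leP r t) => //= tr.
  by rewrite /K /powp subr_gt0 ltNge (ltW tr)/= mul0r mul0r mulr0.
split; last by rewrite /Rintegral intE/= mulrA mulVf ?mul1r// gt_eqF.
apply/integrableP; split; first by apply/measurable_EFinP; exact: measurable_funTS.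
under eq_integral do rewrite /= ger0_norm//.
by rewrite intE ltry.
Qed.

Lemma abel_integrableB (a t0 t : R) (h1 h2 : R -> R) (G1 G2 : R) : 0 < a ->
  measurable_fun setT h1 -> (forall r, 0 <= h1 r) ->
  (forall r, r < t0 -> h1 r = 0) ->
  measurable_fun setT h2 -> (forall r, 0 <= h2 r) ->
  (forall r, r < t0 -> h2 r = 0) ->
  conv (EFin \o K a) (EFin \o h1) t = G1%:E ->
  conv (EFin \o K a) (EFin \o h2) t = G2%:E ->
  mu.-integrable `[t0, t] (EFin \o (fun r => (t - r) `^ (a - 1) * (h1 r - h2 r))) /\
  (euler_gamma a)^-1 *
    \int[mu]_(r in `[t0, t]) ((t - r) `^ (a - 1) * (h1 r - h2 r)) = G1 - G2.
Proof.
move=> a0 mh1 h10 h1t0 mh2 h20 h2t0 /(abel_integrable _ _ _ _ _ a0 mh1 h10 h1t0)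
  [i1 <-] /(abel_integrable _ _ _ _ _ a0 mh2 h20 h2t0) [i2 <-].
rewrite (_ : (fun r => _ * (h1 r - h2 r)) = (fun r =>
    (t - r) `^ (a - 1) * h1 r - (t - r) `^ (a - 1) * h2 r)); last first.
  by apply/funext => r; rewrite mulrBr.
split; first by apply: (integrableB _ i1 i2); exact: measurable_itv.
by rewrite RintegralB// mulrBr.
Qed.

Lemma integrable_powR_sub a t : 0 < a -> 0 <= t ->
  mu.-integrable `[0, t] (EFin \o (fun r => (t - r) `^ (a - 1))).
Proof.
move=> a0 t0.
(* The constant 1 on r >= 0 is the kernel of order 1 advanced by 1, the advance covering r = 0 as
   well. Its convolution with the kernel of order [a] is already known to be finite. *)
have h := conv_abel_kernel_trunc 1 a 1 t ltr01 a0 ltr01 t0.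
have [] := abel_integrable a 0 t _ _ a0 _ _ _ h.
- apply: measurable_fun_ifT; first exact: measurable_fun_ler.
  + apply: (measurableT_comp (measurable_abel_kernel 1)).
    exact: measurable_funD.
  + exact: measurable_cst.
- by move=> r; case: ifP => // _; exact: abel_kernel_ge0.
- by move=> r r0; rewrite leNgt r0.
move=> hi _; apply: eq_integrable hi => // r /set_mem/=.
rewrite in_itv/= => /andP[r0 _]; rewrite r0 /K /powp ltr_wpDl//.
by rewrite subrr powRr0 euler_gamma1 divr1 mulr1.
Qed.

Lemma continuous_abel_integrable a t (g : R -> R) : 0 < a -> 0 <= t ->
  {within `[0, t], continuous g} ->
  mu.-integrable `[0, t] (EFin \o (fun r => (t - r) `^ (a - 1) * g r)).
Proof.
move=> a0 t0 cg.
have := @integrableMl _ _ _ mu `[0, t] (measurable_itv _) _ g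
  (integrable_powR_sub a t a0 t0).
apply.
- by apply: subspace_continuous_measurable_fun => //; exact: measurable_itv.
- have /compact_bounded [M [Mr hM]] := continuous_compact cg (segment_compact (a:=0) (b:=t)).
  exists M; split => // x Mx y ty; apply: hM => //=; by exists y.
Qed.

End fractional_integral.

(** * The forcing produced by the affine history *)

Section history_response.
Context {R : realType}.
Notation mu := (@lebesgue_measure R).
Notation K := abel_kernel.
Implicit Types alpha tau t r s : R.

(** The derivative of the history is the constant [y0 / tau], and the constant 1 after t0 is the
    kernel of order 1; the semigroup law raises the order to (1 - alpha) + 1. *)
Lemma caputo_affine_history alpha tau y0 t0 t : 0 < alpha < 1 -> t0 <= t ->
  caputo alpha t0 (affine_history tau y0) t = y0 / tau * K (2 - alpha) (t - t0).
Proof.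
move=> /andP[al0 al1] t0t.
have a0 : 0 < 1 - alpha by rewrite subr_gt0.
have dphi r : (affine_history tau y0)^`()%classic r = y0 / tau.
  have /is_derive1_caratheodory[_] : exists g : R -> R,
      [/\ forall z, affine_history tau y0 z - affine_history tau y0 r = g z * (z - r),
          {for r, continuous g} & g r = y0 / tau].
    exists (cst (y0 / tau)); split => //; last exact: cvg_cst.
    by move=> z; rewrite /affine_history/=; ring.
  by rewrite derive1E.
have mh : measurable_fun setT (fun r : R => K 1 (r - t0)).
  apply: (measurableT_comp (measurable_abel_kernel 1)); exact: measurable_funB.
have [|||i E] := abel_integrable (1 - alpha) t0 t (fun r => K 1 (r - t0))
  (K (2 - alpha) (t - t0)) a0 mh.
- by move=> r; exact: abel_kernel_ge0.
- by move=> r rt0; rewrite /K /powp subr_gt0 ltNge (ltW rt0)/= mul0r.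
- rewrite (conv_shiftr (EFin \o K (1 - alpha)) (EFin \o K 1)).
  + rewrite (conv_abel_kernel _ _ _ a0 ltr01).
    by rewrite (_ : 1 - alpha + 1 = 2 - alpha); last by ring.
  + exact: measurable_EFin_abel_kernel.
  + exact: measurable_EFin_abel_kernel.
  + by move=> r; rewrite lee_fin abel_kernel_ge0.
  + by move=> r; rewrite lee_fin abel_kernel_ge0.
rewrite -E /caputo mulrCA -(RintegralZl _ _ i); last exact: measurable_itv.
congr (_ * fine _); apply: eq_integral_itv_bounded.
- apply: measurable_funTS; under eq_fun do rewrite dphi.
  by apply: measurable_funM => //; exact: measurable_powR_sub.
- apply: measurable_funTS; apply: measurable_funM => //.
  by apply: measurable_funM => //; exact: measurable_powR_sub.
- move=> r; rewrite in_itv/= => /andP[r0 _].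
  rewrite dphi /K /powp subr_gt0 r0 subrr powRr0 euler_gamma1 divr1 mulr1 mulrC.
  by congr (_ * _ `^ _); ring.
Qed.

Lemma history_forcing_affine alpha tau y0 t : 0 < alpha < 1 -> 0 < tau -> 0 <= t ->
  history_forcing alpha tau (affine_history tau y0) t =
  y0 / tau * (K (2 - alpha) t - K (2 - alpha) (t + tau)).
Proof.
move=> al tau0 t0; rewrite /history_forcing !caputo_affine_history//.
  by rewrite subr0 opprK mulrBr.
by rewrite (le_trans _ t0)// oppr_le0 ltW.
Qed.

Variables (a tau : R) (a0 : 0 < a) (tau0 : 0 < tau).

(** The cut at 0 reflects that the fractional integral starts at 0, whereas the advanced kernel is
    already positive after [- tau]. *)
Definition delayed_kernel r : R := if 0 <= r then K a (r + tau) else 0.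

(** Closed form of the fractional integral of order [b] of [delayed_kernel]. Its sign, its
    measurability and its behaviour under further integration are all deduced from that
    description. *)
Definition beta_response b s : R :=
  if 0 <= s then (s + tau) `^ (a + b - 1) / euler_gamma (a + b) *
    (1 - incomplete_beta (tau / (s + tau)) a b) else 0.

Lemma delayed_kernel_ge0 r : 0 <= delayed_kernel r.
Proof. by rewrite /delayed_kernel; case: ifP => // _; exact: abel_kernel_ge0. Qed.

Lemma measurable_delayed_kernel : measurable_fun setT delayed_kernel.
Proof.
apply: measurable_fun_ifT.
- exact: measurable_fun_ler.
- apply: (measurableT_comp (measurable_abel_kernel a)); exact: measurable_funD.
- exact: measurable_cst.
Qed.

Lemma conv_delayed_kernel b s : 0 < b ->
  conv (EFin \o K b) (EFin \o delayed_kernel) s = (beta_response b s)%:E.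
Proof.
move=> b0; rewrite /beta_response; case: (leP 0 s) => s0.
  exact: conv_abel_kernel_trunc.
rewrite /conv; apply: integral0_eq => r _ /=.
rewrite /delayed_kernel; case: (leP 0 r) => r0; last by rewrite mule0.
rewrite /K /powp subr_gt0 ltNge (le_trans (ltW s0) r0)/= mul0r.
by rewrite mul0e.
Qed.

Lemma beta_response_ge0 b s : 0 < b -> 0 <= beta_response b s.
Proof.
move=> b0; rewrite -lee_fin -conv_delayed_kernel//; apply: conv_ge0 => r.
  by rewrite lee_fin abel_kernel_ge0.
by rewrite lee_fin delayed_kernel_ge0.
Qed.

Lemma measurable_beta_response b : 0 < b -> measurable_fun setT (beta_response b).
Proof.
move=> b0; apply/measurable_EFinP.
rewrite (_ : EFin \o _ = conv (EFin \o K b) (EFin \o delayed_kernel)); last first.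
  by apply/funext => s; rewrite conv_delayed_kernel.
apply: measurable_conv.
- exact: measurable_EFin_abel_kernel.
- by apply/measurable_EFinP; exact: measurable_delayed_kernel.
- by move=> r; rewrite lee_fin abel_kernel_ge0.
- by move=> r; rewrite lee_fin delayed_kernel_ge0.
Qed.

(** Associativity moves the two Abel kernels together, where the semigroup law adds their orders; no
    identity between incomplete beta functions is required. *)
Lemma conv_beta_response b c s : 0 < b -> 0 < c ->
  conv (EFin \o K c) (EFin \o beta_response b) s = (beta_response (c + b) s)%:E.
Proof.
move=> b0 c0.
rewrite (_ : EFin \o beta_response b =
    conv (EFin \o K b) (EFin \o delayed_kernel)); last first.
  by apply/funext => r; rewrite conv_delayed_kernel.
rewrite conv_assoc.
- rewrite (_ : conv (EFin \o K c) (EFin \o K b) = EFin \o K (c + b)).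
    by rewrite conv_delayed_kernel ?addr_gt0.
  by apply/funext => r; rewrite conv_abel_kernel.
- exact: measurable_EFin_abel_kernel.
- exact: measurable_EFin_abel_kernel.
- by apply/measurable_EFinP; exact: measurable_delayed_kernel.
- by move=> r; rewrite lee_fin abel_kernel_ge0.
- by move=> r; rewrite lee_fin abel_kernel_ge0.
- by move=> r; rewrite lee_fin delayed_kernel_ge0.
Qed.

End history_response.

(** * Integrals of complex-valued functions *)

Section complex_integral.
Context {R : realType}.
Notation mu := (@lebesgue_measure R).
Implicit Types (z v : R[i]) (g : R -> R[i]) (h : R -> R).

Lemma complexReM z v : complex.Re (z * v) =
  complex.Re z * complex.Re v - complex.Im z * complex.Im v.
Proof. by case: z => a b; case: v => c d. Qed.

Lemma complexImM z v : complex.Im (z * v) =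
  complex.Re z * complex.Im v + complex.Im z * complex.Re v.
Proof. by case: z => a b; case: v => c d. Qed.

Lemma complexReD z v : complex.Re (z + v) = complex.Re z + complex.Re v.
Proof. by case: z => a b; case: v => c d. Qed.

Lemma complexImD z v : complex.Im (z + v) = complex.Im z + complex.Im v.
Proof. by case: z => a b; case: v => c d. Qed.

(** Integrability is bundled with the value because [integralC] alone always has a value, while its
    linearity rests on integrability of both parts. *)
Definition has_integralC (D : set R) g v :=
  [/\ mu.-integrable D (EFin \o (fun r => complex.Re (g r))),
      mu.-integrable D (EFin \o (fun r => complex.Im (g r)))
    & integralC D g = v].

Variables (D : set R) (mD : measurable D).

Lemma eq_has_integralC g1 g2 v : (forall r, D r -> g1 r = g2 r) ->
  has_integralC D g1 v -> has_integralC D g2 v.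
Proof.
move=> g12 [iR iI <-]; split.
- by apply: eq_integrable iR => // r /set_mem Dr /=; rewrite g12.
- by apply: eq_integrable iI => // r /set_mem Dr /=; rewrite g12.
- by congr Complex; apply: eq_Rintegral => r /set_mem Dr; rewrite g12.
Qed.

Lemma has_integralCD g1 g2 v1 v2 :
  has_integralC D g1 v1 -> has_integralC D g2 v2 ->
  has_integralC D (fun r => g1 r + g2 r) (v1 + v2).
Proof.
move=> [iR1 iI1 <-] [iR2 iI2 <-]; split.
- rewrite (_ : (fun r => _) =
    (fun r => complex.Re (g1 r) + complex.Re (g2 r))); last first.
    by apply/funext => r; rewrite complexReD.
  by apply: (integrableD _ iR1 iR2).
- rewrite (_ : (fun r => _) =
    (fun r => complex.Im (g1 r) + complex.Im (g2 r))); last first.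
    by apply/funext => r; rewrite complexImD.
  by apply: (integrableD _ iI1 iI2).
- rewrite /integralC.
  under eq_Rintegral do rewrite complexReD.
  under [X in Complex _ X]eq_Rintegral do rewrite complexImD.
  by rewrite RintegralD// RintegralD.
Qed.

Lemma has_integralCZ z g v :
  has_integralC D g v -> has_integralC D (fun r => z * g r) (z * v).
Proof.
move=> [iR iI <-].
have iZ (c : R) h : mu.-integrable D (EFin \o h) ->
    mu.-integrable D (EFin \o (fun r => c * h r)).
  by move=> ih; apply: (integrableZl _ _ ih).
split.
- rewrite (_ : (fun r => _) = (fun r => complex.Re z * complex.Re (g r) -
      complex.Im z * complex.Im (g r))); last first.
    by apply/funext => r; rewrite complexReM.
  by apply: (integrableB _ (iZ _ _ iR) (iZ _ _ iI)).
- rewrite (_ : (fun r => _) = (fun r => complex.Re z * complex.Im (g r) +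
      complex.Im z * complex.Re (g r))); last first.
    by apply/funext => r; rewrite complexImM.
  by apply: (integrableD _ (iZ _ _ iI) (iZ _ _ iR)).
- rewrite /integralC.
  under eq_Rintegral do rewrite complexReM.
  under [X in Complex _ X]eq_Rintegral do rewrite complexImM.
  rewrite RintegralB ?RintegralD; try exact: mD; try exact: iZ.
  rewrite !RintegralZl//.
  by case: z.
Qed.

Lemma has_integralCB g1 g2 v1 v2 :
  has_integralC D g1 v1 -> has_integralC D g2 v2 ->
  has_integralC D (fun r => g1 r - g2 r) (v1 - v2).
Proof.
move=> h1 /(has_integralCZ (-1)) /(has_integralCD _ _ _ _ h1).
by rewrite mulN1r; apply: eq_has_integralC => r _; rewrite mulN1r.
Qed.

Lemma has_integralC_real h : mu.-integrable D (EFin \o h) ->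
  has_integralC D (fun r => (h r)%:C%C) (\int[mu]_(r in D) h r)%:C%C.
Proof.
move=> ih; split => //=; first exact: integrable0.
by congr Complex; rewrite /Rintegral integral0.
Qed.

Lemma has_integralC_sum n (g : nat -> R -> R[i]) (v : nat -> R[i]) :
  (forall k, has_integralC D (g k) (v k)) ->
  has_integralC D (fun r => \sum_(0 <= k < n) g k r) (\sum_(0 <= k < n) v k).
Proof.
move=> hg; elim: n => [|n IH].
  rewrite big_geq//.
  have h0 : mu.-integrable D (EFin \o (fun=> 0 : R)) by exact: integrable0.
  have := has_integralC_real (fun=> 0) h0.
  rewrite /Rintegral integral0; apply: eq_has_integralC => r _.
  by rewrite big_geq.
rewrite big_nat_recr//=.
by apply: eq_has_integralC (has_integralCD _ _ _ _ IH (hg n)) => r _;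
  rewrite big_nat_recr.
Qed.

End complex_integral.

(** * Continuity of real and imaginary parts *)

Section complex_continuity.
Context {R : realType}.

Lemma cvg_Re {T : Type} {F : set_system T} {FF : Filter F} (g : T -> R[i])
    (z : R[i]) : (g : T -> R[i]^o) @ F --> (z : R[i]^o) ->
  (fun x => complex.Re (g x)) @ F --> complex.Re z.
Proof.
move=> /cvgrPdist_lt gz; apply/cvgrPdist_lt => e e0.
have e0' : 0 < e%:C%C by rewrite ltcR.
apply: filterS (gz _ e0') => x; rewrite -ltcR; apply: le_lt_trans.
rewrite (_ : complex.Re z - complex.Re (g x) = complex.Re (z - g x)).
  exact: normc_ge_Re.
by case: (z) => a b; case: (g x).
Qed.

Lemma cvg_Im {T : Type} {F : set_system T} {FF : Filter F} (g : T -> R[i])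
    (z : R[i]) : (g : T -> R[i]^o) @ F --> (z : R[i]^o) ->
  (fun x => complex.Im (g x)) @ F --> complex.Im z.
Proof.
move=> /cvgrPdist_lt gz; apply/cvgrPdist_lt => e e0.
have e0' : 0 < e%:C%C by rewrite ltcR.
apply: filterS (gz _ e0') => x; rewrite -ltcR; apply: le_lt_trans.
(* Multiplication by i turns the imaginary part into minus a real part without changing the
   modulus. *)
rewrite (_ : complex.Im z - complex.Im (g x) = - complex.Re ('i%C * (z - g x))).
  rewrite normrN (le_trans (normc_ge_Re _))// normrM.
  by rewrite [X in X * _]normc_def/= expr0n/= expr1n add0r sqrtr1 mul1r.
by rewrite complexReM/= mul0r mul1r sub0r opprK; case: (z) => a b; case: (g x).
Qed.

End complex_continuity.

(** * The method of steps *)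

Section delay_recursion.
Context {R : realType}.
Notation mu := (@lebesgue_measure R).
Notation K := abel_kernel.
Variables (alpha tau : R).
Hypotheses (al : 0 < alpha < 1) (tau0 : 0 < tau).

Let a0 : 0 < alpha. Proof. by case/andP: al. Qed.

Let a2 : 0 < 2 - alpha.
Proof. by case/andP: al => _ a1; rewrite subr_gt0 (lt_trans a1)// ltr1n. Qed.

(** The fractional integral of order (k + 1) alpha of the forcing, without the factor y0 / tau. The
    order of its first kernel is (2 - alpha) + (k + 1) alpha. *)
Definition forcing_response (k : nat) (s : R) : R :=
  K (alpha * k%:R + 2) s -
  beta_response (2 - alpha) tau (k.+1%:R * alpha) s.

Let kp (k : nat) : 0 < alpha * k%:R + 2.
Proof. by rewrite ltr_wpDl// mulr_ge0 ?(ltW a0). Qed.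

Let kb (k : nat) : 0 < k.+1%:R * alpha.
Proof. by rewrite mulr_gt0. Qed.

Lemma forcing_response_lt0 k s : s < 0 -> forcing_response k s = 0.
Proof.
move=> s0; rewrite /forcing_response /beta_response /K /powp.
by rewrite leNgt s0/= ltNge (ltW s0)/= mul0r subrr.
Qed.

Lemma forcing_responseE k s : 0 <= s ->
  forcing_response k s = s `^ (alpha * k%:R + 1) / euler_gamma (alpha * k%:R + 2) -
    (s + tau) `^ (alpha * k%:R + 1) / euler_gamma (alpha * k%:R + 2) *
    (1 - incomplete_beta (tau / (s + tau)) (2 - alpha) (k.+1%:R * alpha)).
Proof.
move=> s0; rewrite /forcing_response /beta_response s0 /K /powp.
have -> : 2 - alpha + k.+1%:R * alpha = alpha * k%:R + 2.
  by rewrite -natr1; ring.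
have -> : alpha * k%:R + 2 - 1 = alpha * k%:R + 1 by ring.
(* At s = 0 the kernel is zero by its cut, and the power is zero because its exponent is
   positive. *)
congr (_ / _ - _); case: ltgtP s0 => // <- _.
by rewrite powR0// gt_eqF// ltr_wpDl// mulr_ge0 ?(ltW a0).
Qed.

(** One more integration of order [alpha] raises the index by one and commutes with the delay [d],
    since a delayed response still vanishes before 0. *)
Lemma delayed_forcing_response k d t : 0 <= d ->
  mu.-integrable `[0, t]
    (EFin \o (fun r => (t - r) `^ (alpha - 1) * forcing_response k (r - d))) /\
  (euler_gamma alpha)^-1 *
    \int[mu]_(r in `[0, t]) ((t - r) `^ (alpha - 1) * forcing_response k (r - d))
  = forcing_response k.+1 (t - d).
Proof.
move=> d0; rewrite [in RHS]/forcing_response.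
have lt0 r : r < 0 -> r - d < 0 by move=> r0; rewrite ltrBlDr add0r (lt_le_trans r0).
have msub : measurable_fun setT (fun r : R => r - d) by exact: measurable_funB.
apply: (abel_integrableB alpha 0 t (fun r => K (alpha * k%:R + 2) (r - d))
  (fun r => beta_response (2 - alpha) tau (k.+1%:R * alpha) (r - d))) => //.
- exact: (measurableT_comp (measurable_abel_kernel _) msub).
- by move=> r; exact: abel_kernel_ge0.
- by move=> r /lt0 r0; rewrite /K /powp ltNge (ltW r0)/= mul0r.
- exact: (measurableT_comp (measurable_beta_response _ _ a2 tau0 _ (kb k)) msub).
- by move=> r; exact: beta_response_ge0.
- by move=> r /lt0 r0; rewrite /beta_response leNgt r0.
- rewrite (conv_shiftr (EFin \o K alpha) (EFin \o K (alpha * k%:R + 2))).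
  + rewrite (conv_abel_kernel _ _ _ a0 (kp k)).
    by rewrite (_ : alpha + _ = alpha * k.+1%:R + 2)// -natr1; ring.
  + exact: measurable_EFin_abel_kernel.
  + exact: measurable_EFin_abel_kernel.
  + by move=> r; rewrite lee_fin abel_kernel_ge0.
  + by move=> r; rewrite lee_fin abel_kernel_ge0.
- rewrite (conv_shiftr (EFin \o K alpha)
    (EFin \o beta_response (2 - alpha) tau (k.+1%:R * alpha))).
  + rewrite (conv_beta_response _ _ a2 tau0 _ _ _ (kb k) a0).
    by rewrite (_ : alpha + _ = k.+2%:R * alpha)// -[k.+2%:R]natr1; ring.
  + exact: measurable_EFin_abel_kernel.
  + by apply/measurable_EFinP; exact: measurable_beta_response.
  + by move=> r; rewrite lee_fin abel_kernel_ge0.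
  + by move=> r; rewrite lee_fin beta_response_ge0.
Qed.

Lemma base_forcing_response t :
  mu.-integrable `[0, t]
    (EFin \o (fun r => (t - r) `^ (alpha - 1) *
       (K (2 - alpha) r - delayed_kernel (2 - alpha) tau r))) /\
  (euler_gamma alpha)^-1 *
    \int[mu]_(r in `[0, t]) ((t - r) `^ (alpha - 1) *
       (K (2 - alpha) r - delayed_kernel (2 - alpha) tau r))
  = forcing_response 0 t.
Proof.
apply: abel_integrableB => //.
- exact: measurable_abel_kernel.
- by move=> r; exact: abel_kernel_ge0.
- by move=> r r0; rewrite /K /powp ltNge (ltW r0)/= mul0r.
- exact: measurable_delayed_kernel.
- by move=> r; exact: delayed_kernel_ge0.
- by move=> r r0; rewrite /delayed_kernel leNgt r0.
- by rewrite (conv_abel_kernel _ _ _ a0 a2) mulr0 add0r addrCA subrr addr0.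
- by rewrite (conv_delayed_kernel _ _ a2 tau0 _ _ a0) mul1r.
Qed.

End delay_recursion.

(** * Comparison of the two integral equations *)

Section delay_problem.
Context {R : realType}.
Notation mu := (@lebesgue_measure R).
Notation K := abel_kernel.
Variables (alpha tau : R) (lambda : R[i]).
Hypotheses (al : 0 < alpha < 1) (tau0 : 0 < tau).

Let a0 : 0 < alpha. Proof. by case/andP: al. Qed.

Lemma within_continuous_shift (T : topologicalType) (u : R -> T) (t : R) :
  {within `[- tau, +oo[, continuous u} ->
  {within `[0, t], continuous (fun r => u (r - tau))}.
Proof.
move=> /subspace_continuousP cu; apply/subspace_continuousP => r.
rewrite /= in_itv/= => /andP[r0 _].
have rt : `[- tau, +oo[%classic (r - tau) by rewrite /= in_itv/= andbT lerBrDr addNr.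
apply: (@cvg_comp _ _ _ (fun r => r - tau) u _ _ _ _ (cu _ rt)) => P hP.
have cs : (fun x : R => x - tau) @ r --> r - tau.
  by apply: cvgB; [exact: cvg_id|exact: cvg_cst].
suff h : nbhs r (fun x => `[0, t]%classic x -> P (x - tau)) by exact: h.
have hQ : nbhs (r - tau) (fun y => `[- tau, +oo[%classic y -> P y) by exact: hP.
have hQr : nbhs r ((fun x => x - tau) @^-1` (fun y => `[- tau, +oo[%classic y -> P y)).
  exact: cs _ hQ.
apply: filterS hQr => x /= hx; rewrite in_itv/= => /andP[x0 _]; apply: hx.
by rewrite in_itv/= andbT lerBrDr addNr.
Qed.

Lemma within_continuous_Re (A : set R) (g : R -> R[i]) :
  {within A, continuous (g : R -> R[i]^o)} ->
  {within A, continuous (fun r => complex.Re (g r))}.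
Proof.
move=> /subspace_continuousP cg; apply/subspace_continuousP => x Ax.
exact: cvg_Re (cg x Ax).
Qed.

Lemma within_continuous_Im (A : set R) (g : R -> R[i]) :
  {within A, continuous (g : R -> R[i]^o)} ->
  {within A, continuous (fun r => complex.Im (g r))}.
Proof.
move=> /subspace_continuousP cg; apply/subspace_continuousP => x Ax.
exact: cvg_Im (cg x Ax).
Qed.

Lemma continuous_abel_integralC (g : R -> R[i]) (t : R) : 0 <= t ->
  {within `[0, t], continuous (g : R -> R[i]^o)} ->
  exists v, has_integralC `[0, t]
    (fun r => ((t - r) `^ (alpha - 1))%:C%C * g r) v.
Proof.
move=> t0 cg; eexists; split; last by [].
- rewrite (_ : (fun r => _) = (fun r => (t - r) `^ (alpha - 1) * complex.Re (g r))).
    exact: continuous_abel_integrable (within_continuous_Re _ _ cg).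
  by apply/funext => r; rewrite complexReM/= mul0r subr0.
- rewrite (_ : (fun r => _) = (fun r => (t - r) `^ (alpha - 1) * complex.Im (g r))).
    exact: continuous_abel_integrable (within_continuous_Im _ _ cg).
  by apply/funext => r; rewrite complexImM/= mul0r addr0.
Qed.

(** The forcing [F] of the problem is kept apart from the [f] in the integrand: for [yhat] only the
    continuous part [f] is treated here, and the history part is integrated explicitly. *)
Lemma has_integralC_delay (phi F f : R -> R) (u : R -> R[i]) (t : R) : 0 <= t ->
  {within `[0, +oo[, continuous f} ->
  delay_solution alpha tau lambda phi F u ->
  exists v, has_integralC `[0, t]
    (fun r => ((t - r) `^ (alpha - 1))%:C%C *
      (lambda * u (r - tau) + (f r)%:C%C)) v.
Proof.
move=> t0 cf [cu _ _].
have := within_continuous_shift _ (u : R -> R[i]^o) t cu.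
have sub : `[0, t]%classic `<=` `[(0:R), +oo[%classic.
  by move=> r /=; rewrite !in_itv/= andbT => /andP[].
have {}cf : {within `[0, t], continuous f} by exact: continuous_subspaceW cf.
have mI : measurable (`[0, t]%classic : set R) by exact: measurable_itv.
move=> /continuous_abel_integralC-/(_ t0)[v /(has_integralCZ _ mI lambda) hv].
have hf := has_integralC_real _ _ (continuous_abel_integrable _ _ _ a0 t0 cf).
exists (lambda * v + (\int[mu]_(r in `[0, t]) ((t - r) `^ (alpha - 1) * f r))%:C%C).
apply: (eq_has_integralC _ mI _ _ _ _ (has_integralCD _ mI _ _ _ _ hv hf)) => r _.
by rewrite rmorphM/=; ring.
Qed.

(** For r in [0, t] with t <= (n + 1) tau, the delayed argument r - tau lies in [- tau, n tau],
    where the induction hypothesis holds. Including the history interval in the statement is what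
    covers r < tau. *)
Lemma solution_difference (y0 : R) (f : R -> R) (y yhat : R -> R[i]) :
  {within `[0, +oo[, continuous f} ->
  delay_solution alpha tau lambda (affine_history tau y0) f y ->
  modified_delay_solution alpha tau lambda (affine_history tau y0) f yhat ->
  forall (n : nat) (t : R), - tau <= t <= n%:R * tau ->
  yhat t - y t = (y0 / tau)%:C%C *
    \sum_(0 <= k < n) lambda ^+ k * (forcing_response alpha tau k (t - k%:R * tau))%:C%C.
Proof.
move=> cf hy hyhat; have [_ yphi yE] := hy; have [_ yhatphi yhatE] := hyhat.
elim=> [|n IH] t /andP[tau_t tn].
  rewrite mul0r in tn.
  by rewrite big_geq// mulr0 yphi ?yhatphi ?tau_t// subrr.
have [t0|t0] := ltP t 0.
  rewrite yphi ?yhatphi ?tau_t ?(ltW t0)// subrr big1_seq ?mulr0// => k _.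
  rewrite forcing_response_lt0 ?mulr0//.
  by rewrite (le_lt_trans _ t0)// gerBl mulr_ge0 ?(ltW tau0).
have mI : measurable (`[0, t]%classic : set R) by exact: measurable_itv.
pose G (u : R -> R[i]) r := ((t - r) `^ (alpha - 1))%:C%C *
  (lambda * u (r - tau) + (f r)%:C%C).
have [v hv] : exists v, has_integralC `[0, t] (G y) v.
  exact: has_integralC_delay hy.
have [vh hvh] : exists v, has_integralC `[0, t] (G yhat) v.
  exact: has_integralC_delay hyhat.
have [ib vb] := base_forcing_response alpha tau al tau0 t.
set B := \int[mu]_(r in _) _ in vb.
have hB := has_integralCZ _ mI (y0 / tau)%:C%C _ _ (has_integralC_real _ _ ib).
have hh := has_integralCD _ mI _ _ _ _ hvh hB.
pose I k := \int[mu]_(r in `[0, t])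
  ((t - r) `^ (alpha - 1) * forcing_response alpha tau k (r - k.+1%:R * tau)).
have hI k : has_integralC `[0, t] (fun r => (lambda ^+ k.+1 * (y0 / tau)%:C%C) *
    ((t - r) `^ (alpha - 1) *
      forcing_response alpha tau k (r - k.+1%:R * tau))%:C%C)
    ((lambda ^+ k.+1 * (y0 / tau)%:C%C) * (I k)%:C%C).
  have [|ik _] := delayed_forcing_response alpha tau al tau0 k (k.+1%:R * tau) t.
    by rewrite mulr_ge0 ?(ltW tau0).
  exact: (has_integralCZ _ mI _ _ _ (has_integralC_real _ _ ik)).
have hsum := has_integralC_sum _ mI n _ _ hI.
have hdiff := has_integralCB _ mI _ _ _ _ hvh hv.
have {hsum hdiff} vhv : vh - v =
    \sum_(0 <= k < n) (lambda ^+ k.+1 * (y0 / tau)%:C%C) * (I k)%:C%C.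
  suff [_ _ <-] : has_integralC `[0, t] (fun r => G yhat r - G y r)
      (\sum_(0 <= k < n) (lambda ^+ k.+1 * (y0 / tau)%:C%C) * (I k)%:C%C).
    by have [_ _ <-] := hdiff.
  apply: eq_has_integralC hsum => // r /=; rewrite in_itv/= => /andP[r0 rt].
  (* The common forcing [f] cancels, leaving lambda times the difference at r - tau, which the
     induction hypothesis expands. *)
  rewrite -mulrBr opprD addrACA subrr addr0 -mulrBr IH; last first.
    rewrite lerBrDr addNr r0/= lerBlDr.
    by rewrite (le_trans rt)// (le_trans tn)// -natr1 mulrDl mul1r.
  rewrite !mulr_sumr; apply: eq_bigr => k _.
  rewrite rmorphM/= exprS -natr1 mulrDl mul1r opprD addrA (addrAC r).
  by ring.
have -> : yhat t - y t = ((euler_gamma alpha)^-1)%:C%C *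
    (vh - v + (y0 / tau)%:C%C * B%:C%C).
  rewrite yhatE// yE//; have [_ _ ->] := hv.
  suff [_ _ ->] : has_integralC `[0, t] (fun r => ((t - r) `^ (alpha - 1))%:C%C *
      (lambda * yhat (r - tau) +
       (f r + history_forcing alpha tau (affine_history tau y0) r)%:C%C))
      (vh + (y0 / tau)%:C%C * B%:C%C).
    by ring.
  apply: eq_has_integralC hh => // r /=; rewrite in_itv/= => /andP[r0 rt].
  rewrite history_forcing_affine// /delayed_kernel r0 /G.
  move: (y0 / tau) (K _ _ - _) => p q.
  by rewrite rmorphM rmorphD/= rmorphM/=; ring.
(* The term k = 0 is the direct effect of the history forcing; the others come from the delayed
   difference with their index raised by one. *)
rewrite [LHS]mulrDr big_nat_recl//= [RHS]mulrDr [LHS]addrC; congr (_ + _).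
  rewrite expr0 mul1r mul0r subr0 -vb rmorphM/=; ring.
rewrite vhv !mulr_sumr; apply: eq_bigr => k _.
have [|_ <-] := delayed_forcing_response alpha tau al tau0 k (k.+1%:R * tau) t.
  by rewrite mulr_ge0 ?(ltW tau0).
rewrite rmorphM/= -/(I k); ring.
Qed.

End delay_problem.

Theorem proposition11 (R : realType) (alpha tau : R) (lambda : R[i])
    (f : R -> R) (y0 : R) (y yhat : R -> R[i])
    (halpha : 0 < alpha < 1) (htau : 0 < tau)
    (hf : {within `[0, +oo[, continuous f})
    (hy : delay_solution alpha tau lambda (affine_history tau y0) f y)
    (hyhat : modified_delay_solution alpha tau lambda
               (affine_history tau y0) f yhat) :
  forall t : R, 0 < t ->
    yhat t - y t =
      (y0 / tau)%:C%C *
      \sum_(0 <= k < (Num.truncn (t / tau)).+1)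
        lambda ^+ k *
        ((t - k%:R * tau) `^ (alpha * k%:R + 1)
           / euler_gamma (alpha * k%:R + 2)
         - (t + tau - k%:R * tau) `^ (alpha * k%:R + 1)
             / euler_gamma (alpha * k%:R + 2)
           * (1 - incomplete_beta (tau / (t + tau - k%:R * tau))
                    (2 - alpha) (k.+1%:R * alpha)))%:C%C.
Proof.
move=> t t0; set n := (Num.truncn (t / tau)).+1.
have tn : t <= n%:R * tau by rewrite -ler_pdivrMr// ltW// truncnS_gt.
rewrite (solution_difference _ _ _ halpha htau _ _ _ _ hf hy hyhat n); last first.
  by rewrite tn andbT (le_trans _ (ltW t0))// oppr_le0 ltW.
congr (_ * _); apply: eq_big_nat => k /andP[_ kn].
(* Up to the integer part of t / tau the arguments are nonnegative, so the closed form applies to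
   every term. *)
have kt : 0 <= t - k%:R * tau.
  rewrite subr_ge0 -ler_pdivlMr//.
  by rewrite -truncn_ge_nat ?divr_ge0 ?ltW.
by rewrite forcing_responseE// [t - _ + tau]addrAC.
Qed.
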